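(* Let $u_2=-4K^2$ and let $w$ be a formal square root of $-u_2\sigma_4=4K^2\sigma_4$. Then, as polynomials in $u_2$ (with $16K^2=-4u_2$) and $\sigma_1,\dots,\sigma_4$, the polynomial $\alpha'_4$ is the product of two (rescaled) discriminants: $$\alpha'_4=\Bigl(16\,\mathrm{discr}_z\bigl(z^3+\sigma_1z^2+(\sigma_2+u_2)z+\sigma_3-2w\bigr)\Bigr)\Bigl(16\,\mathrm{discr}_z\bigl(z^3+\sigma_1z^2+(\sigma_2+u_2)z+\sigma_3+2w\bigr)\Bigr).$$
   Context: An $(n+1)$-gon is semicyclic if it is inscribed in a circle and one of its sides is a diameter of that circle (polygons are oriented and may be non-convex and self-intersecting; the area $K$ is the signed area $\oint x\,dy$). For $n\ge2$, $\alpha'_n$ is the unique irreducible polynomial with integer coefficients in $n+1$ variables, monic in the first variable, homogeneous when the first variable has degree $2$ and the others degree $1$, such that $\alpha'_n(16K^2,a_1^2,\dots,a_n^2)=0$ whenever $a_1,\dots,a_n$ are the lengths of the sides, excluding a diameter, of a semicyclic $(n+1)$-gon of area $K$. It is symmetric in the last $n$ variables, hence a polynomial in $16K^2$ and the elementary symmetric functions $\sigma_1,\dots,\sigma_n$ of $a_1^2,\dots,a_n^2$. $\mathrm{discr}_z$ is the discriminant of a polynomial in $z$. *)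

(* Defs.v *)
From mathcomp Require Export all_boot all_order all_algebra.
From mathcomp Require Export reals.
From mathcomp Require Export mpoly.

Set Implicit Arguments.
Unset Strict Implicit.
Unset Printing Implicit Defensive.

Import Order.TTheory GRing.Theory Num.Theory.
Local Open Scope ring_scope.

Definition dist (R : realType) (A B : R * R) : R :=
  Num.sqrt ((A.1 - B.1) ^+ 2 + (A.2 - B.2) ^+ 2).

(* A closed oriented m-gon is the family P of its vertices in cyclic order;
   ordS is the cyclic successor, and side k joins P k to P (ordS k). *)
Definition side (R : realType) (m : nat) (P : 'I_m -> R * R) (k : 'I_m) : R :=
  dist (P k) (P (ordS k)).

(* The line integral of x dy along the boundary: on a segment from A to B it is
   the mean of the abscissas times the increment of the ordinate. *)
Definition area (R : realType) (m : nat) (P : 'I_m -> R * R) : R :=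
  \sum_(k < m) ((P k).1 + (P (ordS k)).1) / 2 * ((P (ordS k)).2 - (P k).2).

(* P is inscribed in a circle of centre c, and side k is a diameter of it:
   c is the midpoint of that side. *)
Definition semicyclic (R : realType) (m : nat) (P : 'I_m -> R * R) (k : 'I_m) :
    Prop :=
  exists (c : R * R) (r : R),
    [/\ 0 < r, forall i, dist (P i) c = r & P k + P (ordS k) = c *+ 2].

(* (16 K^2, a_1^2, ..., a_n^2), where a_1, ..., a_n are the lengths of the sides
   other than side k, listed in the order of their indices. *)
Definition semicyclic_point (R : realType) (n : nat) (P : 'I_n.+1 -> R * R)
    (k j : 'I_n.+1) : R :=
  if unlift ord0 j is Some i then side P (lift k i) ^+ 2 else 16 * area P ^+ 2.

(* The element 0 is excluded since 0 = 0 * 0. *)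
Definition irreducible_elt (D : idomainType) (p : D) : Prop :=
  p \isn't a GRing.unit /\
  forall q r : D, p = q * r -> q \is a GRing.unit \/ r \is a GRing.unit.

Definition monic_first (n : nat) (p : {mpoly int[n.+1]}) : Prop :=
  exists d : nat, forall m : 'X_{1..n.+1},
    m \in msupp (p - 'X_ord0 ^+ d) -> (m ord0 < d)%N.

(* Homogeneous, with weight 2 for the first variable and 1 for the others. *)
Definition weighted_homog (n : nat) (p : {mpoly int[n.+1]}) : Prop :=
  exists d : nat, forall m : 'X_{1..n.+1},
    m \in msupp p -> (2 * m ord0 + \sum_(i < n) m (lift ord0 i) = d)%N.

(* The property characterizing alpha'_n. *)
Definition is_alpha' (R : realType) (n : nat) (p : {mpoly int[n.+1]}) : Prop :=
  [/\ irreducible_elt p, monic_first p, weighted_homog p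
    & forall (P : 'I_n.+1 -> R * R) (k : 'I_n.+1), semicyclic P k ->
        (map_mpoly (intr : int -> R) p).@[semicyclic_point P k] = 0].

(* (t, sigma_1, ..., sigma_n) as polynomials in (t, x_1, ..., x_n), where
   sigma_i is the i-th elementary symmetric polynomial in x_1, ..., x_n. *)
Definition sigma_subst (n : nat) : n.+1.-tuple {mpoly int[n.+1]} :=
  [tuple if i == ord0 then 'X_ord0
         else mesym n int i \mPo [tuple 'X_(lift ord0 j) | j < n] | i < n.+1].

(* Discriminant of a monic polynomial of degree d, in a ring where d is nonzero:
   the general formula (-1)^(d(d-1)/2) Res(p, p') / lead_coef p without the
   division.  The Sylvester matrix of the library has its rows and columns in
   the reverse of the usual order, which changes the resultant by the sign
   (-1)^(d(d-1)) = 1 here. *)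
Definition discr (R : comNzRingType) (p : {poly R}) : R :=
  (-1) ^+ 'C((size p).-1, 2) * resultant p p^`().

(* In Z[u_2, sigma_1, ..., sigma_4] variable 0 is u_2 and variable i is sigma_i. *)
Definition u2 : {mpoly int[5]} := 'X_ord0.
Definition sigma (i : nat) : {mpoly int[5]} := 'X_(inord i).

(* (-4 u_2, sigma_1, ..., sigma_4). *)
Definition u2_subst : 5.-tuple {mpoly int[5]} :=
  [tuple if i == ord0 then - (4 * u2) else 'X_i | i < 5].

(* Z[u_2, sigma_1, ..., sigma_4][w] / (w^2 + u_2 sigma_4); the modulus is monic,
   so this is the genuine quotient, with w the class 'qX. *)
Definition w_modulus : {poly {mpoly int[5]}} := 'X^2 + (u2 * sigma 4)%:P.
Definition w_ring : comNzRingType := {poly %/ w_modulus}.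
Definition w : w_ring := qpolyX w_modulus.
Definition to_w : {rmorphism {mpoly int[5]} -> w_ring} := qpolyC w_modulus.

Definition cubic (e : w_ring) : {poly w_ring} :=
  'X^3 + to_w (sigma 1) *: 'X^2 + to_w (sigma 2 + u2) *: 'X
  + (to_w (sigma 3) + e)%:P.

(* Main.v *)
Require Import Defs.
From mathcomp Require Import ring lra zify qpoly intdiv.
From mathcomp Require classical_sets topology normedtype realfun.
Set Implicit Arguments.
Unset Strict Implicit.
Unset Printing Implicit Defensive.
Import Order.TTheory GRing.Theory Num.Theory.
Local Open Scope ring_scope.

(** The product of the two discriminants is [F^2 - t sigma_4 G^2] in [t = 16 K^2]
    (see [heron4] below); call it [H], a monic polynomial of degree 6 in [t].

    [H] vanishes at semicyclic pentagons: if [D] is the diameter and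
    [u = (D^2 - sigma_1) / 2], the cubic is [(z + D^2) (z - u)^2] for one of the
    two signs of [w].

    Divide alpha by [H] as polynomials in [t].  For positive integers
    [x_1, ..., x_4] with [x_1 >= 4 x_j] there is a semicyclic pentagon whose squared
    sides are the [x_j] (intermediate values, the radius being the unknown), and for
    [x] in a suitable residue class modulo 11 the polynomial [H(t, x)] is irreducible
    modulo 11.  Its root [t = 16 K^2] is then also a root of the remainder, of degree
    less than 6, which must vanish at [x].  Such [x] being Zariski dense, [H] divides
    alpha, and alpha is irreducible and monic in [t]. *)

(** * Existence of a semicyclic pentagon with given sides *)

Section IntermediateValue.
Import classical_sets topology normedtype realfun.
Import numFieldNormedType.Exports.

(* With D = 1 / y and a, b, c, d the chords of half-angles alpha, ..., delta, the
   last equation says that cos (alpha + beta + gamma + delta) = 0.  The left-hand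
   side is 1 at y = 0, and at y = 1 / d it is - sin (alpha + beta + gamma), where
   the three angles are at most pi / 6. *)
Lemma exists_quarter_turn (R : realType) (a b c d : R) :
  0 <= a -> 0 <= b -> 0 <= c -> 0 < d ->
  2 * a <= d -> 2 * b <= d -> 2 * c <= d ->
  exists y p q r s : R, [/\ 0 < y,
    [/\ p ^+ 2 + (a * y) ^+ 2 = 1, q ^+ 2 + (b * y) ^+ 2 = 1,
        r ^+ 2 + (c * y) ^+ 2 = 1 & s ^+ 2 + (d * y) ^+ 2 = 1] &
    ((p * q - a * y * (b * y)) * r - (a * y * q + p * (b * y)) * (c * y)) * s
    - ((a * y * q + p * (b * y)) * r + (p * q - a * y * (b * y)) * (c * y))
      * (d * y) = 0].
Proof.
move=> a0 b0 c0 d0 ad bd cd.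
pose h (e y : R) := Num.sqrt (1 - (e * y) ^+ 2).
pose f y := ((h a y * h b y - a * y * (b * y)) * h c y
    - (a * y * h b y + h a y * (b * y)) * (c * y)) * h d y
  - ((a * y * h b y + h a y * (b * y)) * h c y
     + (h a y * h b y - a * y * (b * y)) * (c * y)) * (d * y).
have cl e : continuous (fun y : R => e * y) by move=> y; exact: mulrl_continuous.
have ch e : continuous (h e).
  move=> y; apply: (@continuous_comp _ _ _ (fun y => 1 - (e * y) ^+ 2) Num.sqrt).
    apply: cvgB; first exact: cvg_cst.
    by apply: (@continuous_comp _ _ _ (fun y => e * y) (fun z => z ^+ 2));
      [exact: cl | exact: exprn_continuous].
  exact: sqrt_continuous.
have cf : continuous f.
  have cD (u v : R -> R) : continuous u -> continuous v ->
      continuous (fun y : R => u y + v y : R).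
    by move=> cu cv y; apply: cvgD; [exact: cu | exact: cv].
  have cB (u v : R -> R) : continuous u -> continuous v ->
      continuous (fun y : R => u y - v y : R).
    by move=> cu cv y; apply: cvgB; [exact: cu | exact: cv].
  have cM (u v : R -> R) : continuous u -> continuous v ->
      continuous (fun y : R => u y * v y : R).
    by move=> cu cv y; apply: cvgM; [exact: cu | exact: cv].
  have c1 : continuous (fun y => h a y * h b y - a * y * (b * y)) by apply: cB; apply: cM.
  have c2 : continuous (fun y => a * y * h b y + h a y * (b * y)) by apply: cD; apply: cM.
  by apply: (cB); apply: (cM) => //; [apply: (cB) | apply: (cD)]; apply: cM.
have h0 e : h e 0 = 1 by rewrite /h mulr0 expr0n subr0 sqrtr1.
have f0 : f 0 = 1 by rewrite /f !h0 !mulr0; ring.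
have di : 0 < d^-1 by rewrite invr_gt0.
have hs e y : (e * y) ^+ 2 <= 1 -> h e y ^+ 2 + (e * y) ^+ 2 = 1.
  by move=> le1; rewrite /h sqr_sqrtr ?subrK // subr_ge0.
have small e y : 0 <= e -> e <= d -> 0 <= y -> y <= d^-1 -> (e * y) ^+ 2 <= 1.
  move=> e0 ed y0 yd; rewrite expr_le1 ?mulr_ge0 //.
  by rewrite (le_trans (ler_pM e0 y0 ed yd)) ?divff // gt_eqF.
have f1 : f d^-1 <= 0.
  have hd : h d d^-1 = 0 by rewrite /h divff ?gt_eqF // expr1n subrr sqrtr0.
  have lt e : 0 <= e -> 2 * e <= d -> 0 <= e / d <= h e d^-1.
    move=> e0 ed; have e2 : e / d <= 2^-1 by rewrite ler_pdivrMr // ; lra.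
    have e3 : 0 <= e / d by rewrite divr_ge0 // ltW.
    rewrite e3 -(@ler_sqr _ (e / d)) ?nnegrE ?sqrtr_ge0 //.
    have le1 : (e / d) ^+ 2 <= 1 by nra.
    by have := hs _ _ le1; nra.
  have /andP[A0 A1] := lt a a0 ad.
  have /andP[B0 B1] := lt b b0 bd.
  have /andP[C0 C1] := lt c c0 cd.
  rewrite /f hd mulr0 divff ?gt_eqF // mulr1 sub0r oppr_le0.
  have p0 := le_trans A0 A1; have q0 := le_trans B0 B1; have r0 := le_trans C0 C1.
  (* The sine of the sum is split as sin alpha cos (beta + gamma) plus two products of nonnegative
     factors; cos (beta + gamma) is nonnegative because each sine is at most its cosine. *)
  have -> : forall x y z u v w : R, (x * v + u * y) * w + (u * v - x * y) * z =
     x * (v * w - y * z) + u * y * w + u * v * z by move=> *; ring.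
  have K : 0 <= h b d^-1 * h c d^-1 - b / d * (c / d) by rewrite subr_ge0 ler_pM.
  by do 2?[apply: addr_ge0]; repeat first [assumption | apply: mulr_ge0].
have [||y] := @IVT R f 0 d^-1 0 (ltW di).
- exact: continuous_subspaceT.
- by rewrite f0 ge_min le_max f1 ler01 orbT.
rewrite in_itv /= => /andP[y0 yd] fy.
exists y, (h a y), (h b y), (h c y), (h d y); split=> //.
  rewrite lt_neqAle y0 andbT; apply/eqP=> y00.
  by move: fy; rewrite -y00 f0 => /eqP; rewrite oner_eq0.
by split; apply: hs; apply: small => //; lra.
Qed.

End IntermediateValue.

(* If e^2 = t s4, then 16 discr (z^3 + s1 z^2 + (s2 - t / 4) z + s3 + e) is
   heron_even + e * heron_odd. *)
Definition heron_even {S : comNzRingType} (t s1 s2 s3 s4 : S) : S :=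
  s1 ^+ 2 * (4 * s2 - t) ^+ 2 - (4 * s2 - t) ^+ 3 - 64 * s1 ^+ 3 * s3
  + 72 * s1 * (4 * s2 - t) * s3 - 432 * (s3 ^+ 2 + t * s4).

Definition heron_odd {S : comNzRingType} (t s1 s2 s3 : S) : S :=
  72 * s1 * (4 * s2 - t) - 64 * s1 ^+ 3 - 864 * s3.

Definition heron4 {S : comNzRingType} (t s1 s2 s3 s4 : S) : S :=
  heron_even t s1 s2 s3 s4 ^+ 2 - t * s4 * heron_odd t s1 s2 s3 ^+ 2.

(* The hypotheses say that z^3 + s1 z^2 + (s2 - t / 4) z + s3 + e, as a polynomial
   in z, is (z + y) (z - m)^2. *)
Lemma heron4_double_root (S : comNzRingType) (y m t s1 s2 s3 s4 e : S) :
  s1 = y - 2 * m -> 4 * s2 = t + 4 * (m ^+ 2 - 2 * y * m) ->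
  s3 + e = y * m ^+ 2 -> e ^+ 2 = t * s4 -> heron4 t s1 s2 s3 s4 = 0.
Proof.
move=> h1 h2 h3 he.
have E : heron_even t s1 s2 s3 s4 + e * heron_odd t s1 s2 s3 = 0.
  rewrite /heron_even /heron_odd -he h2 h1.
  have -> : s3 = y * m ^+ 2 - e by rewrite -h3 addrK.
  ring.
by rewrite /heron4 -he -exprMn subr_sqr E mulr0.
Qed.

Section Angles.
Variables (S : comNzRingType) (c1 c2 c3 s1 s2 s3 : S).
Let C := (c1 * c2 - s1 * s2) * c3 - (s1 * c2 + c1 * s2) * s3.
Let Z := (s1 * c2 + c1 * s2) * c3 + (c1 * c2 - s1 * s2) * s3.

(* The cosine and sine of a fourth angle making the sum +/- pi / 2 are +/- Z and
   +/- C, with the same sign. *)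
Lemma angle_identities :
  c1 ^+ 2 + s1 ^+ 2 = 1 -> c2 ^+ 2 + s2 ^+ 2 = 1 -> c3 ^+ 2 + s3 ^+ 2 = 1 ->
  let T := s1 * c1 + s2 * c2 + s3 * c3 + C * Z in
  let e1 := s1 ^+ 2 + s2 ^+ 2 + s3 ^+ 2 + C ^+ 2 in
  4 * (s1 ^+ 2 * s2 ^+ 2 + s1 ^+ 2 * s3 ^+ 2 + s2 ^+ 2 * s3 ^+ 2
       + e1 * C ^+ 2 - C ^+ 2 * C ^+ 2) - T ^+ 2 = (e1 + 3) * (e1 - 1) /\
  4 * (s1 ^+ 2 * s2 ^+ 2 * s3 ^+ 2 + s1 ^+ 2 * s2 ^+ 2 * C ^+ 2
       + s1 ^+ 2 * s3 ^+ 2 * C ^+ 2 + s2 ^+ 2 * s3 ^+ 2 * C ^+ 2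
       + T * (s1 * s2 * s3 * C)) = (1 - e1) ^+ 2.
Proof.
move=> h1 h2 h3.
(* Both identities become polynomial once they are made homogeneous in each
   pair (c_i, s_i) by means of N_i = c_i^2 + s_i^2. *)
have H1 : let N1 := c1 ^+ 2 + s1 ^+ 2 in let N2 := c2 ^+ 2 + s2 ^+ 2 in
    let N3 := c3 ^+ 2 + s3 ^+ 2 in
    let T := s1 * c1 * (N2 * N3) + s2 * c2 * (N1 * N3) + s3 * c3 * (N1 * N2) + C * Z in
    let e1 := s1 ^+ 2 * (N2 * N3) + s2 ^+ 2 * (N1 * N3) + s3 ^+ 2 * (N1 * N2) + C ^+ 2 in
    let N := N1 * N2 * N3 in
    4 * (s1 ^+ 2 * s2 ^+ 2 * N3 * N + s1 ^+ 2 * s3 ^+ 2 * N2 * N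
       + s2 ^+ 2 * s3 ^+ 2 * N1 * N
       + e1 * C ^+ 2 - C ^+ 2 * C ^+ 2) - T ^+ 2 = (e1 + 3 * N) * (e1 - N).
  by rewrite /C /Z /=; ring.
have H2 : let N1 := c1 ^+ 2 + s1 ^+ 2 in let N2 := c2 ^+ 2 + s2 ^+ 2 in
    let N3 := c3 ^+ 2 + s3 ^+ 2 in
    let T := s1 * c1 * (N2 * N3) + s2 * c2 * (N1 * N3) + s3 * c3 * (N1 * N2) + C * Z in
    let e1 := s1 ^+ 2 * (N2 * N3) + s2 ^+ 2 * (N1 * N3) + s3 ^+ 2 * (N1 * N2) + C ^+ 2 in
    let N := N1 * N2 * N3 in
  4 * (s1 ^+ 2 * s2 ^+ 2 * s3 ^+ 2 * N + s1 ^+ 2 * s2 ^+ 2 * N3 * C ^+ 2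
       + s1 ^+ 2 * s3 ^+ 2 * N2 * C ^+ 2 + s2 ^+ 2 * s3 ^+ 2 * N1 * C ^+ 2
       + T * (s1 * s2 * s3 * C)) = (N - e1) ^+ 2.
  by rewrite /C /Z /=; ring.
by move: H1 H2; rewrite /= h1 h2 h3 !mulr1.
Qed.
End Angles.

(** * Chords of a circle and half-angles *)

Lemma sqr_dist (R : realType) (A B : R * R) :
  dist A B ^+ 2 = (A.1 - B.1) ^+ 2 + (A.2 - B.2) ^+ 2.
Proof. by rewrite sqr_sqrtr // addr_ge0 ?sqr_ge0. Qed.

(* The point of the circle of radius r at twice the angle of cosine u.1 and
   sine u.2. *)
Definition double_angle_point {R : realType} (r : R) (u : R * R) : R * R :=
  (r * (u.1 ^+ 2 - u.2 ^+ 2), r * (2 * u.1 * u.2)).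

(** Complex multiplication: the angles of [u] and [v] add. *)
Definition rotate {R : realType} (u v : R * R) : R * R :=
  (u.1 * v.1 - u.2 * v.2, u.2 * v.1 + u.1 * v.2).

Lemma rotate_norm (R : realType) (u v : R * R) :
  u.1 ^+ 2 + u.2 ^+ 2 = 1 -> v.1 ^+ 2 + v.2 ^+ 2 = 1 ->
  (rotate u v).1 ^+ 2 + (rotate u v).2 ^+ 2 = 1.
Proof. by move=> hu hv; rewrite -[1]mulr1 -[X in X * _]hu -hv /rotate /=; ring. Qed.

Lemma double_angle_point_norm (R : realType) (r : R) (u : R * R) :
  0 < r -> u.1 ^+ 2 + u.2 ^+ 2 = 1 -> dist (double_angle_point r u) 0 = r.
Proof.
move=> r0 hu; rewrite /dist.
set d := (X in Num.sqrt X); have -> : d = r ^+ 2.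
  by rewrite -[RHS]mulr1 -[1](expr1n _ 2) -hu /d /=; ring.
by rewrite sqrtr_sqr gtr0_norm.
Qed.

Lemma double_angle_point_side (R : realType) (r : R) (u v : R * R) :
  u.1 ^+ 2 + u.2 ^+ 2 = 1 -> v.1 ^+ 2 + v.2 ^+ 2 = 1 ->
  dist (double_angle_point r u) (double_angle_point r (rotate u v)) ^+ 2 =
  (2 * r * v.2) ^+ 2.
Proof.
move=> hu hv; rewrite sqr_dist.
(* In complex notation u^2 - (u v)^2 = u^2 (1 - v^2); the squared modulus is taken factor by
   factor. *)
transitivity (r ^+ 2 * (u.1 ^+ 2 + u.2 ^+ 2) ^+ 2 *
  ((1 - (v.1 ^+ 2 + v.2 ^+ 2) + 2 * v.2 ^+ 2) ^+ 2 + 4 * v.1 ^+ 2 * v.2 ^+ 2)).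
  by rewrite /rotate /=; ring.
have -> : v.1 ^+ 2 = 1 - v.2 ^+ 2 by rewrite -hv addrK.
rewrite hu; ring.
Qed.

(** The first term is the signed area of the triangle formed by the centre, [A] and [B]; the second
    telescopes along the polygon. *)
Lemma double_angle_point_area (R : realType) (r : R) (u v : R * R) :
  u.1 ^+ 2 + u.2 ^+ 2 = 1 -> v.1 ^+ 2 + v.2 ^+ 2 = 1 ->
  let A := double_angle_point r u in let B := double_angle_point r (rotate u v) in
  (A.1 + B.1) / 2 * (B.2 - A.2) =
  r ^+ 2 * (v.1 * v.2) + (B.1 * B.2 - A.1 * A.2) / 2.
Proof.
move=> hu hv /=.
have -> : r ^+ 2 * (v.1 * v.2) =
    r ^+ 2 * (v.1 * v.2) * (u.1 ^+ 2 + u.2 ^+ 2) ^+ 2 by rewrite hu; ring.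
by field.
Qed.

(** Going around the circle by twice the angles from [exists_quarter_turn] leads from [(rad, 0)] to
    the opposite point [(- rad, 0)], so the closing side is a diameter. The factor 4 between squared
    sides is the factor 2 between sides required there. *)
Lemma exists_semicyclic_pentagon (R : realType) (x : 'I_4 -> R) :
  (forall i, 0 < x i) -> (forall i : 'I_4, (0 < i)%N -> 4 * x i <= x 0) ->
  let a := x 0 in let b := x 1 in let c := x 2 in let d := x ord_max in
  exists (t : R) (P : 'I_5 -> R * R) (k : 'I_5), [/\ semicyclic P k,
    forall j, semicyclic_point P k j =
      (if unlift ord0 j is Some i then x i else t) &
    heron4 t (a + b + c + d)
      (a * b + a * c + a * d + b * c + b * d + c * d)
      (a * b * c + a * b * d + a * c * d + b * c * d) (a * b * c * d) = 0].
Proof.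
move=> x0 x4 a b c d.
have sq e : 0 < e -> exists2 u : R, 0 < u & u ^+ 2 = e.
  by move=> e0; exists (Num.sqrt e); rewrite ?sqrtr_gt0 ?sqr_sqrtr ?ltW.
have [u u0 ua] := sq a (x0 _); have [v v0 vb] := sq b (x0 _).
have [w w0 wc] := sq c (x0 _); have [z z0 zd] := sq d (x0 _).
have half (i : 'I_4) (e : R) : (0 < i)%N -> 0 < e -> e ^+ 2 = x i -> 2 * e <= u.
  move=> i0 /ltW e0 ex; have u1 := ltW u0; rewrite -ler_sqr ?nnegrE ?mulr_ge0 //.
  rewrite ua exprMn ex; have -> : 2 ^+ 2 = 4 :> R by ring.
  exact: (x4 i i0).
(* The longest side [u] takes the place of [d], so its cosine [p] comes last. *)
have [y [q [r [s [p [y0 [hq hr hs hp] G]]]]]] :=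
  exists_quarter_turn (ltW v0) (ltW w0) (ltW z0) u0
   (half 1 _ isT v0 vb) (half 2 _ isT w0 wc) (half ord_max _ isT z0 zd).
pose V1 := (p, u * y); pose V2 := (q, v * y).
pose V3 := (r, w * y); pose V4 := (s, z * y).
pose U2 := rotate V1 V2; pose U3 := rotate U2 V3; pose U4 := rotate U3 V4.
have N0 : (1 : R, 0 : R).1 ^+ 2 + (1 : R, 0 : R).2 ^+ 2 = 1.
  by rewrite /= expr1n expr0n addr0.
have N2 : U2.1 ^+ 2 + U2.2 ^+ 2 = 1 by exact: rotate_norm.
have N3 : U3.1 ^+ 2 + U3.2 ^+ 2 = 1 by exact: rotate_norm.
have N4 : U4.1 ^+ 2 + U4.2 ^+ 2 = 1 by exact: rotate_norm.
have U40 : U4.1 = 0 by rewrite -G /U4 /U3 /U2 /=; ring.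
have H2 : U4.2 ^+ 2 = 1 by rewrite -N4 U40 expr0n add0r.
(* The four half-angles add up to [h] times a quarter turn, with [h ^+ 2 = 1]; so the cosine and
   sine of the fourth are [h] times the sine and cosine of the sum of the other three. *)
pose h := U4.2.
have G1 : U3.1 * V4.1 = U3.2 * V4.2 by apply/eqP; rewrite -subr_eq0; apply/eqP.
have s4 : V4.2 = h * U3.1.
  transitivity (U3.2 * (U3.1 * V4.1) + U3.1 ^+ 2 * V4.2); last first.
    by rewrite /h /U4 /rotate /=; ring.
  by rewrite G1 -[LHS]mul1r -N3; ring.
have c4 : V4.1 = h * U3.2.
  transitivity (U3.2 ^+ 2 * V4.1 + U3.1 * (U3.2 * V4.2)); last first.
    by rewrite /h /U4 /rotate /=; ring.
  by rewrite -G1 -[LHS]mul1r -N3; ring.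
(* A chord of half-angle with sine [u * y] has length [u] when the diameter is [y^-1]. *)
pose rad := (2 * y)^-1.
pose U (n : nat) :=
  match n with 0%N => (1, 0) | 1%N => V1 | 2%N => U2 | 3%N => U3 | _ => U4 end.
pose W n := double_angle_point rad (U n).
pose P (i : 'I_5) := W i.
pose T := u * y * p + v * y * q + w * y * r + z * y * s.
have rad0 : 0 < rad by rewrite invr_gt0 mulr_gt0.
have rV1 : rotate (1, 0) V1 = V1 by rewrite /rotate /=; congr pair; ring.
have sideE (e : R) : (2 * rad * (e * y)) ^+ 2 = e ^+ 2.
  by congr (_ ^+ 2); rewrite /rad; field; rewrite gt_eqF.
have areaP : area P = rad ^+ 2 * T.
  pose F m n := ((W m).1 + (W n).1) / 2 * ((W n).2 - (W m).2).
  have -> : area P =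
      F 0%N 1%N + (F 1%N 2%N + (F 2%N 3%N + (F 3%N 4%N + (F 4%N 0%N + 0)))).
    by rewrite /area !big_ord_recl big_ord0.
  pose M n := (W n).1 * (W n).2 / 2.
  have F0 : F 0%N 1%N = rad ^+ 2 * (V1.1 * V1.2) + M 1%N - M 0%N.
    rewrite /F [W 1%N](_ : _ = double_angle_point rad (rotate (1, 0) V1)).
      by rewrite double_angle_point_area // rV1 mulrBl addrA.
    by rewrite rV1.
  have F1 : F 1%N 2%N = rad ^+ 2 * (V2.1 * V2.2) + M 2%N - M 1%N.
    by rewrite [LHS]double_angle_point_area // mulrBl addrA.
  have F2 : F 2%N 3%N = rad ^+ 2 * (V3.1 * V3.2) + M 3%N - M 2%N.
    by rewrite [LHS]double_angle_point_area // mulrBl addrA.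
  have F3 : F 3%N 4%N = rad ^+ 2 * (V4.1 * V4.2) + M 4%N - M 3%N.
    by rewrite [LHS]double_angle_point_area // mulrBl addrA.
  (* The diameter lies on the axis of abscissas: it contributes nothing, and the telescoping terms
     vanish at its ends. *)
  have W4 : (W 4%N).2 = 0.
    by rewrite [LHS](_ : _ = rad * (2 * U4.1 * U4.2)) // U40 mulr0 mul0r mulr0.
  have W0 : (W 0%N).2 = 0 by rewrite /= !mulr0.
  rewrite F0 F1 F2 F3 /F W4 W0 /M W4 W0 /T /=; ring.
have S0 : dist (W 0%N) (W 1%N) ^+ 2 = (2 * rad * (u * y)) ^+ 2.
  by have := @double_angle_point_side _ rad (1, 0) V1 N0 hp; rewrite rV1.
exists (16 * (rad ^+ 2 * T) ^+ 2), P, ord_max; split.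
- exists 0, rad; split=> //.
    case; do 5?[case=> //]; move=> i5; apply: double_angle_point_norm => //.
  have -> : P ord_max + P (ordS ord_max) = W 4%N + W 0%N by [].
  have -> : W 4%N = (- rad, 0).
    rewrite /W /double_angle_point [U 4%N](_ : _ = U4) //.
    by rewrite U40 H2 expr0n sub0r mulrN1 !(mulr0, mul0r).
  have -> : W 0%N = (rad, 0).
    by rewrite /W /double_angle_point /= expr1n expr0n subr0 mulr1 !mulr0.
  by rewrite mul0rn; congr pair => /=; rewrite ?addNr ?addr0.
- move=> j; rewrite /semicyclic_point; case: unliftP => [i|] _; last by rewrite areaP.
  have W0 : side P (lift ord_max i) = dist (W i) (W i.+1).
    by case: i => -[|[|[|[|//]]]].
  rewrite W0.
  case: i {W0} => -[|[|[|[|//]]]] i4 /=.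
  + rewrite S0 sideE ua; congr x; exact: val_inj.
  + rewrite [LHS]double_angle_point_side // sideE vb; congr x; exact: val_inj.
  + rewrite [LHS]double_angle_point_side // sideE wc; congr x; exact: val_inj.
  + rewrite [LHS]double_angle_point_side // sideE zd; congr x; exact: val_inj.
have [I1 I2] := angle_identities hp hq hr.
pose k := y ^- 2; pose C := U3.1.
have y20 : y ^+ 2 != 0 by rewrite expf_neq0 ?gt_eqF.
have scale e : e ^+ 2 = (e * y) ^+ 2 * k by rewrite exprMn mulfK.
have zC : (z * y) ^+ 2 = C ^+ 2 by rewrite [z * y]s4 exprMn [h ^+ 2]H2 mul1r.
have TE : T = u * y * p + v * y * q + w * y * r + C * U3.2.
  by rewrite /T [z * y]s4 [s]c4 mulrACA -expr2 [h ^+ 2]H2 mul1r.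
have tE : 16 * (rad ^+ 2 * T) ^+ 2 = T ^+ 2 * k ^+ 2.
  by rewrite /rad /k; field; rewrite gt_eqF.
rewrite tE -ua -vb -wc -zd (scale u) (scale v) (scale w) (scale z) zC.
rewrite -/U3 -/C -TE in I1 I2.
move: I1 I2; rewrite /= -[(p * q - _) * r - _]/C.
clear zC scale areaP tE TE; move: (u * y) (v * y) (w * y) C T => a' b' c' d' T' I1 I2.
set e1 := (X in heron4 _ X); set e2 := (X in heron4 _ _ X).
set e3 := (X in heron4 _ _ _ X); set e4 := (X in heron4 _ _ _ _ X).
(* [k] is the squared diameter. The roots of the cubic are [- k] and twice [m], so [m] is forced by
   their sum [- e1]; [I1] and [I2] give the other two coefficients. *)
pose m := (k - e1) / 2; have E : 2 * m = k - e1 by rewrite /m; field.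
apply: (@heron4_double_root _ k m _ e1 e2 e3 e4 (T' * (a' * b' * c' * d') * k ^+ 3)).
- by rewrite E; ring.
- have -> : 4 * (m ^+ 2 - 2 * k * m) = (2 * m) ^+ 2 - 4 * k * (2 * m) by ring.
  rewrite E; move/(congr1 (fun e => T' ^+ 2 * k ^+ 2 + k ^+ 2 * e)): I1 => I1.
  by apply: etrans (etrans _ I1) _; rewrite /e1 /e2; ring.
- have n4 : 4 != 0 :> R by rewrite pnatr_eq0.
  apply: (mulfI n4); have -> : 4 * (k * m ^+ 2) = k * (2 * m) ^+ 2 by ring.
  rewrite E; move/(congr1 (fun e => k ^+ 3 * e)): I2 => I2.
  by apply: etrans (etrans _ I2) _; rewrite /e1 /e3; ring.
- by rewrite /e4; ring.
Qed.

(** * Discriminants of cubics *)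

(** Indexing the entries by natural numbers gives the minors of a row expansion the same shape, so
    that small determinants are computed by rewriting. *)
Definition nat_det (S : comNzRingType) (n : nat) (f : nat -> nat -> S) : S :=
  \det (\matrix_(i < n, j < n) f i j).

Lemma nat_detE (S : comNzRingType) m n (A : 'M[S]_m) (f : nat -> nat -> S) :
  m = n -> (forall i j, A i j = f i j) -> \det A = nat_det n f.
Proof.
by move=> e; case: n / e => fE; congr (\det _); apply/matrixP=> i j; rewrite mxE.
Qed.

Lemma nat_det0 (S : comNzRingType) (f : nat -> nat -> S) : nat_det 0 f = 1.
Proof. exact: det_mx00. Qed.

Lemma nat_detS (S : comNzRingType) n (f : nat -> nat -> S) :
  nat_det n.+1 f = \sum_(j < n.+1) f 0%N j *
    ((-1) ^+ j * nat_det n (fun i k => f i.+1 (bump j k))).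
Proof.
rewrite [LHS](expand_det_row _ ord0); apply: eq_bigr => j _; rewrite mxE.
by congr (_ * (_ * \det _)); apply/matrixP=> i k; rewrite !mxE.
Qed.

(** The hypothesis [3 != 0] keeps the derivative of degree 2, which fixes the size of the Sylvester
    matrix. *)
Lemma discr_monic_cubic (S : comNzRingType) (a b c : S) : 3 != 0 :> S ->
  discr ('X^3 + a *: 'X^2 + b *: 'X + c%:P) =
  a ^+ 2 * b ^+ 2 - 4 * b ^+ 3 - 4 * a ^+ 3 * c + 18 * a * b * c - 27 * c ^+ 2.
Proof.
move=> n3; set p := (X in discr X).
have pE k : p`_k = (k == 3)%:R + a * (k == 2)%:R + b * (k == 1)%:R + c *+ (k == 0)%N.
  by rewrite !coefD !coefZ !coefXn coefX coefC; case: (k == 0)%N.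
have sp : size p = 4%N.
  rewrite /p -!addrA size_polyDl ?size_polyXn //.
  rewrite (leq_ltn_trans (size_polyD _ _)) // gtn_max.
  rewrite (leq_ltn_trans (size_scale_leq _ _)) ?size_polyXn //.
  rewrite (leq_ltn_trans (size_polyD _ _)) // gtn_max.
  rewrite (leq_ltn_trans (size_scale_leq _ _)) ?size_polyX //.
  by rewrite (leq_ltn_trans (size_polyC_leq1 _)).
have sq : size p^`() = 3%N.
  apply/eqP; rewrite eqn_leq; apply/andP; split.
    by rewrite -ltnS -sp lt_size_deriv // -size_poly_eq0 sp.
  rewrite ltnNge; apply/negP => s2.
  have : p^`()`_2 = 0 by rewrite nth_default.
  by rewrite coef_deriv pE /= !mulr0 !addr0 => /eqP; apply/negP.
(* Entries of the Sylvester matrix: two shifted rows of [p], then three of its derivative. The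
   boolean multiplicities clear the entries left of each shift, where truncated subtraction would
   give the constant term. *)
pose f i j : S := if (i < 2)%N then p`_(j - i) *+ (i <= j)%N
                  else p`_(j - (i - 2)).+1 *+ (j - (i - 2)).+1 *+ (i - 2 <= j)%N.
rewrite /discr sp (_ : resultant p p^`() = nat_det 5 f); last first.
  apply: nat_detE; first by rewrite sp sq.
  move=> i j; rewrite Sylvester_mxE /f; case: splitP => k ->.
    by have -> : (k < 2)%N by apply: leq_trans (ltn_ord k) _; rewrite sq.
  have -> : ((size p^`()).-1 + k = 2 + k)%N by rewrite sq.
  by rewrite ltnNge leq_addr /= addKn coef_deriv.
have [f0 f1 f2 [f3 f4]] : [/\ forall j, f 0%N j = [:: c; b; a; 1; 0]`_j,
    forall j, f 1%N j = [:: 0; c; b; a; 1]`_j,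
    forall j, f 2%N j = [:: b; 2 * a; 3; 0; 0]`_j &
    (forall j, f 3%N j = [:: 0; b; 2 * a; 3; 0]`_j) /\
    (forall j, f 4%N j = [:: 0; 0; b; 2 * a; 3]`_j)].
  by split; last split; move=> -[|[|[|[|[|j]]]]];
    rewrite /f /= !pE /subn /= ?nth_nil; ring.
rewrite nat_detS !big_ord_recl !big_ord0 !f0 /= mul0r.
rewrite !nat_detS !big_ord_recl !big_ord0 !f1 /= !mul0r.
rewrite !nat_detS !big_ord_recl !big_ord0 !f2 /= !mul0r.
rewrite !nat_detS !big_ord_recl !big_ord0 !f3 /= !mul0r.
rewrite !nat_detS !big_ord_recl !big_ord0 !f4 /= !mul0r !nat_det0.
rewrite /bump /=; ring.
Qed.

(** * The product of the two discriminants in the quotient ring *)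

Lemma eq_heron4 (S : comNzRingType) (t t' s1 s1' s2 s2' s3 s3' s4 s4' : S) :
  t = t' -> s1 = s1' -> s2 = s2' -> s3 = s3' -> s4 = s4' ->
  heron4 t s1 s2 s3 s4 = heron4 t' s1' s2' s3' s4'.
Proof. by move=> -> -> -> -> ->. Qed.

Lemma rmorph_heron4 (S T : comNzRingType) (f : {rmorphism S -> T}) (t s1 s2 s3 s4 : S) :
  f (heron4 t s1 s2 s3 s4) = heron4 (f t) (f s1) (f s2) (f s3) (f s4).
Proof.
rewrite /heron4 /heron_even /heron_odd.
(* The numerals are abstracted first: unification would unfold them. *)
move: (rmorph_nat f 4) (rmorph_nat f 64) (rmorph_nat f 72).
move: (rmorph_nat f 432) (rmorph_nat f 864).
move: (4%:R : S) (64%:R : S) (72%:R : S) (432%:R : S) (864%:R : S).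
move=> n1 n2 n3 n4 n5 <- <- <- <- <-.
by rewrite !(rmorphB, rmorphD, rmorphM, rmorphXn).
Qed.

Lemma monic_w_modulus : w_modulus \is monic.
Proof.
rewrite /w_modulus monicE lead_coefDl ?lead_coefXn // size_polyXn.
by rewrite (leq_ltn_trans (size_polyC_leq1 _)).
Qed.

Lemma size_w_modulus : size w_modulus = 3%N.
Proof. by rewrite size_polyDl size_polyXn // (leq_ltn_trans (size_polyC_leq1 _)). Qed.

Lemma w_sqr : w ^+ 2 = - to_w (u2 * sigma 4).
Proof.
apply/eqP; rewrite -addr_eq0; apply/eqP.
have -> : to_w (u2 * sigma 4) = in_qpoly w_modulus (u2 * sigma 4)%:P.
  apply: val_inj; rewrite [RHS]in_qpoly_small //.
  by rewrite (leq_ltn_trans (size_polyC_leq1 _)) ?size_mk_monic_gt1.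
rewrite /w expr2 -in_qpolyM -in_qpolyD -expr2; apply: val_inj => /=.
(* [mk_monic] returns [w_modulus] itself, as it is monic and of size greater than 1. *)
by rewrite /mk_monic size_w_modulus monic_w_modulus Pdiv.RingMonic.rmodpp ?monic_w_modulus.
Qed.

Lemma w_ring_natr_neq0 n : n.+1%:R != 0 :> w_ring.
Proof.
apply/eqP => n0; have : to_w n.+1%:R = 0 by rewrite rmorph_nat.
move/(congr1 val) => /= /polyC_inj /eqP; rewrite -mpolyC_nat.
by rewrite mpolyC_eq0 pnatr_eq0.
Qed.

(** Each factor is [E + e * O] with [e = 2 * v] or [- (2 * v)], and [e ^+ 2 = t * s4] for
    [t = - (4 * u)]; the product of these conjugates is [heron4]. *)
Lemma heron4_discr (S : comNzRingType) (u s1 s2 s3 s4 v : S) : 3 != 0 :> S ->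
  v ^+ 2 = - (u * s4) ->
  let p e := 'X^3 + s1 *: 'X^2 + (s2 + u) *: 'X + (s3 + e)%:P in
  heron4 (- (4 * u)) s1 s2 s3 s4 = 16 * discr (p (- (2 * v))) * (16 * discr (p (2 * v))).
Proof.
move=> n3 hv p; rewrite /p !discr_monic_cubic //.
set E := heron_even (- (4 * u)) s1 s2 s3 s4; set O := heron_odd (- (4 * u)) s1 s2 s3.
have hs e : e ^+ 2 = 4 * v ^+ 2 ->
    16 * (s1 ^+ 2 * (s2 + u) ^+ 2 - 4 * (s2 + u) ^+ 3 - 4 * s1 ^+ 3 * (s3 + e)
      + 18 * s1 * (s2 + u) * (s3 + e) - 27 * (s3 + e) ^+ 2) = E + e * O.
  move=> he; rewrite /E /O /heron_even /heron_odd.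
  have -> : - (4 * u) * s4 = e ^+ 2 by rewrite he hv; ring.
  by ring.
rewrite !hs ?sqrrN ?exprMn; try by ring.
have -> : heron4 (- (4 * u)) s1 s2 s3 s4 = E ^+ 2 - 4 * v ^+ 2 * O ^+ 2.
  by rewrite /heron4 -/E -/O hv; ring.
by ring.
Qed.

Definition heron_sigma : {mpoly int[5]} :=
  heron4 'X_ord0 (sigma 1) (sigma 2) (sigma 3) (sigma 4).

Lemma heron_sigma_u2 : to_w (heron_sigma \mPo u2_subst) =
      (16 * discr (cubic (- (2 * w)))) * (16 * discr (cubic (2 * w))).
Proof.
have s_subst (i : 'I_5) : i != ord0 -> 'X_i \mPo u2_subst = 'X_i.
  by move=> i0; rewrite comp_mpolyXU -tnth_nth tnth_mktuple (negPf i0).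
have sE k : (0 < k < 5)%N -> sigma k \mPo u2_subst = sigma k.
  by move=> /andP[k0 k5]; rewrite s_subst // -val_eqE /= inordK // -lt0n.
have -> : heron_sigma \mPo u2_subst =
    heron4 (- (4 * u2)) (sigma 1) (sigma 2) (sigma 3) (sigma 4).
  apply: etrans (rmorph_heron4 (comp_mpoly u2_subst) _ _ _ _ _) _.
  apply: eq_heron4; [|exact: sE..].
  by rewrite [LHS]comp_mpolyXU -tnth_nth tnth_mktuple eqxx.
rewrite rmorph_heron4 rmorphN rmorphM rmorph_nat.
rewrite (@heron4_discr _ _ _ _ _ _ w) ?w_ring_natr_neq0 //; last by rewrite w_sqr rmorphM.
by rewrite /cubic !rmorphD.
Qed.

(** * Irreducibility modulo 11 *)

Section HornerRemainder.
Variable F : fieldType.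
Implicit Types (d u s : seq F) (k : F).

(* Sequences list the coefficients of degree < size d, constant term first, except
   the argument s of horner_rem and horner_poly, whose leading coefficient is first. *)
Definition monic_of d : {poly F} := 'X^(size d) + Poly d.

(** Multiplication by X and addition of [k] modulo [monic_of d]: [last k u] is the coefficient
    pushed to degree [size d], which is [k] itself when [u] is empty. *)
Definition horner_step d u k : seq F :=
  [seq z.1 - z.2 * last k u | z <- zip (k :: u) d].

Definition horner_rem d s : seq F := foldl (horner_step d) (nseq (size d) 0) s.

Definition horner_poly s : {poly F} := foldl (fun p k => p * 'X + k%:P) 0 s.

Lemma size_monic_of d : size (monic_of d) = (size d).+1.
Proof. by rewrite size_polyDl size_polyXn // ltnS size_Poly. Qed.

Lemma size_horner_step d u k : size u = size d -> size (horner_step d u k) = size d.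
Proof. by move=> su; rewrite size_map size2_zip //= su. Qed.

Lemma size_horner_rem d s : size (horner_rem d s) = size d.
Proof.
rewrite /horner_rem; move: (nseq _ _) (size_nseq (size d) (0 : F)).
by elim: s => //= k s IH u su; apply: IH; exact: size_horner_step.
Qed.

Lemma horner_stepE d u k : size u = size d ->
  Poly u * 'X + k%:P - Poly (horner_step d u k) = last k u *: monic_of d.
Proof.
move=> su; have -> : Poly u * 'X + k%:P = Poly (k :: u) by rewrite -cons_poly_def.
apply/polyP=> i; rewrite coefB coefZ coefD coefXn !coef_Poly.
have [lt_i | ge_i] := ltnP i (size d).
  rewrite (nth_map (0, 0)) ?size2_zip /= ?su //.
  rewrite nth_zip_cond size2_zip /= ?su // lt_i /= (ltn_eqF lt_i) add0r.
  ring.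
rewrite (nth_default _ (_ : size (horner_step d u k) <= i)%N) ?size_horner_step //.
rewrite (nth_default _ ge_i) addr0 subr0.
move: ge_i; rewrite leq_eqVlt => /predU1P[<-|gt_i].
  by rewrite eqxx mulr1 -su (last_nth 0).
by rewrite (gtn_eqF gt_i) mulr0 nth_default //= su.
Qed.

Lemma horner_remP d s : monic_of d %| horner_poly s - Poly (horner_rem d s).
Proof.
have := size_nseq (size d) (0 : F); rewrite /horner_poly /horner_rem.
have : monic_of d %| 0 - Poly (nseq (size d) (0 : F)).
  rewrite (_ : Poly _ = 0) ?subrr ?dvdp0 //.
  by apply/polyP=> i; rewrite coef_Poly nth_nseq coef0 if_same.
move: (nseq _ _) => u; move: (0 : {poly F}) => p.
elim: s p u => //= k s IH p u pu su; apply: IH; last exact: size_horner_step.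
rewrite (_ : _ - _ = (p - Poly u) * 'X +
  (Poly u * 'X + k%:P - Poly (horner_step d u k))); last by ring.
by rewrite horner_stepE // dvdp_add ?dvdp_mulr // -mul_polyC dvdp_mull.
Qed.

(** The remainder has degree less than [size d], so divisibility forces it to be 0; divisibility is
    thus refuted by a computation on lists. *)
Lemma monic_of_dvd d s : monic_of d %| horner_poly s -> horner_rem d s = nseq (size d) 0.
Proof.
have h1 := horner_remP d s => h2.
have {h1 h2} : monic_of d %| Poly (horner_rem d s) by rewrite (dvdp_subr _ h2) in h1.
move=> dv; have P0 : Poly (horner_rem d s) = 0.
  apply: contraTeq dv => nz; rewrite gtNdvdp // size_monic_of ltnS.
  by rewrite (leq_trans (size_Poly _)) // size_horner_rem.
apply: (@eq_from_nth _ 0); rewrite ?size_horner_rem ?size_nseq // => i lt_i.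
by rewrite nth_nseq lt_i -coef_Poly P0 coef0.
Qed.

Lemma monic_is_monic_of (p : {poly F}) :
  p \is monic -> exists2 d, size p = (size d).+1 & p = monic_of d.
Proof.
move=> mp; have sp : (0 < size p)%N by rewrite size_poly_gt0 monic_neq0.
have st : size (take (size p).-1 p) = (size p).-1 by rewrite size_takel ?leq_pred.
exists (take (size p).-1 p); first by rewrite st prednK.
rewrite /monic_of st; apply/polyP=> i.
rewrite coefD coefXn coef_Poly; have [lt_i|] := ltnP i (size p).-1.
  by rewrite nth_take // (ltn_eqF lt_i) add0r.
rewrite leq_eqVlt => /predU1P[<-|gt_i].
  by rewrite eqxx [X in _ + X]nth_default ?st // addr0; exact/monicP.
rewrite (gtn_eqF gt_i) add0r !nth_default // ?st ?(ltnW gt_i) //.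
by rewrite -(prednK sp).
Qed.

End HornerRemainder.

Fixpoint words (T : Type) (els : seq T) n : seq (seq T) :=
  if n is n'.+1 then [seq x :: d | x <- els, d <- words els n'] else [:: [::]].

Lemma mem_words (T : eqType) (els d : seq T) :
  {subset d <= els} -> d \in words els (size d).
Proof.
elim: d => //= x d IH sub; apply/allpairsP; exists (x, d); split=> //=.
  by apply: sub; rewrite mem_head.
by apply: IH => y yd; apply: sub; rewrite inE yd orbT.
Qed.

Definition F11_elements : seq 'F_11 := [seq k%:R | k <- iota 0 11].

Lemma mem_F11_elements (x : 'F_11) : x \in F11_elements.
Proof.
apply/mapP; exists (val x); first by rewrite mem_iota ltn_ord.
by rewrite natr_Zp.
Qed.

Definition sextic_mod11 : {poly 'F_11} :=
  horner_poly [:: 1; 1; 7%:R; 0; 6%:R; 4%:R; 9%:R].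

Lemma sextic_mod11E : sextic_mod11 =
  'X^6 + 'X^5 + 7 * 'X^4 + 6 * 'X^2 + 4 * 'X + 9.
Proof. by rewrite /sextic_mod11 /horner_poly /= !polyC_natr ?polyC0 ?polyC1; ring. Qed.

(** Exhaustive check of the 11 + 11^2 + 11^3 monic polynomials of degrees 1 to 3. *)
Lemma sextic_mod11_remainders n : (0 < n < 4)%N ->
  all (fun d => horner_rem d [:: 1; 1; 7%:R; 0; 6%:R; 4%:R; 9%:R] != nseq (size d) 0)
    (words F11_elements n).
Proof. by case: n => [|[|[|[|//]]]] // _; vm_compute. Qed.

Lemma sextic_mod11_no_small_factor (d : seq 'F_11) :
  (0 < size d < 4)%N -> ~~ (monic_of d %| sextic_mod11).
Proof.
move=> /sextic_mod11_remainders /allP/(_ d) h; apply/negP => /monic_of_dvd /eqP.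
by apply/negP; apply: h; apply: mem_words => x _; exact: mem_F11_elements.
Qed.

Lemma size_sextic_mod11 : size sextic_mod11 = 7%N.
Proof.
have -> : sextic_mod11 = monic_of [:: 9%:R; 4%:R; 6%:R; 0; 7%:R; 1].
  rewrite sextic_mod11E /monic_of /= !cons_poly_def !polyC_natr polyC0 polyC1; ring.
by rewrite size_monic_of.
Qed.

(** In a nontrivial factorization of a sextic one factor has degree at most 3, and the search has
    excluded degrees 1 to 3. *)
Lemma irreducible_sextic_mod11 : irreducible_poly sextic_mod11.
Proof.
split=> [|q sq dq]; first by rewrite size_sextic_mod11.
have p0 : sextic_mod11 != 0 by rewrite -size_poly_eq0 size_sextic_mod11.
have q0 : q != 0 by apply: contraTneq dq => ->; rewrite dvd0p.
have no_small e : e %| sextic_mod11 -> e != 0 -> (1 < size e < 5)%N -> False.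
  move=> de e0 se; have me : (lead_coef e)^-1 *: e \is monic.
    by rewrite monicE lead_coefZ mulVf // lead_coef_eq0.
  have [d sd ed] := monic_is_monic_of me.
  move: sd; rewrite size_scale ?invr_eq0 ?lead_coef_eq0 // => sd.
  have /negP[] : ~~ (monic_of d %| sextic_mod11).
    by apply: sextic_mod11_no_small_factor; rewrite sd in se.
  by rewrite -ed dvdpZl ?invr_eq0 ?lead_coef_eq0.
have sq0 : (0 < size q)%N by rewrite size_poly_gt0.
rewrite -dvdp_size_eqp // eqn_leq dvdp_leq //= leqNgt; apply/negP => lt_q.
have [r er] := dvdpP _ _ dq.
have r0 : r != 0 by apply: contraNneq p0 => r0; rewrite er r0 mul0r.
have := size_mul r0 q0; rewrite -er size_sextic_mod11 => s8.
rewrite size_sextic_mod11 in lt_q.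
have [le4 | gt4] := leqP (size q) 4.
  by apply: (no_small q) => //; lia.
apply: (no_small r) => //; first by rewrite er dvdp_mulIl.
move: s8 lt_q gt4; case: (size q) => [|[|[|[|[|[|[|n]]]]]]] //;
  by rewrite addnC !addSn add0n => -[<-].
Qed.

(* The common root excludes a Bezout identity over Z, so the gcd is a proper
   factor of P of positive degree, which is still one modulo p. *)
Lemma small_root_eq0 (R : numDomainType) (F : fieldType) (P Q : {poly int}) (t : R) :
  P \is monic -> irreducible_poly (map_poly (intr : int -> F) P) ->
  root (map_poly intr P) t -> root (map_poly intr Q) t ->
  (size Q < size P)%N -> Q = 0.
Proof.
move=> mP irrP rP rQ lt_QP; apply: contraTeq isT => Q0.
have P0 : P != 0 by exact: monic_neq0.
have [[u v] /= /eqpP [[a b] /= /andP[a0 b0] E]] := Bezoutp P Q.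
set g := gcdp P Q in E.
have g0 : g != 0 by rewrite gcdp_eq0 negb_and P0.
have rg : root (map_poly intr g) t.
  have : (map_poly (intr : int -> R) (b *: g)).[t] = 0.
    rewrite -E map_polyZ hornerZ rmorphD !rmorphM hornerD !hornerM.
    by rewrite (rootP rP) (rootP rQ) !mulr0 addr0 mulr0.
  rewrite map_polyZ hornerZ => /eqP; rewrite mulf_eq0 intr_eq0 (negPf b0) /=.
  by move=> ?; apply/rootP/eqP.
have g_gt1 : (1 < size g)%N.
  rewrite -(size_map_inj_poly (@intr_inj R) (erefl : intr 0 = 0)).
  apply: root_size_gt1 rg.
  by rewrite -size_poly_eq0 (size_map_inj_poly (@intr_inj R)) ?size_poly_eq0.
have lt_gP : (size g < size P)%N.
  by apply: leq_ltn_trans lt_QP; rewrite dvdp_leq // dvdp_gcdr.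
(* Gauss's lemma: the primitive part of [g] divides [P] over the integers. As [P] is monic, the
   leading coefficient of that part stays nonzero in [F], so reduction keeps its degree. *)
have [r Er] := dvdpP_int (dvdp_gcdl P Q : g %| P).
have lc : (lead_coef (zprimitive g))%:~R * (lead_coef r)%:~R = 1 :> F.
  by rewrite -intrM -lead_coefM -Er (monicP mP).
have lc0 : (lead_coef (zprimitive g))%:~R != 0 :> F.
  by apply: contra_eqN lc => /eqP->; rewrite mul0r eq_sym oner_eq0.
have sg : size (map_poly (intr : int -> F) (zprimitive g)) = size g.
  by rewrite size_map_poly_id0 // size_zprimitive.
have sP : size (map_poly (intr : int -> F) P) = size P.
  by rewrite size_map_poly_id0 // (monicP mP) oner_eq0.
have /eqp_size : map_poly (intr : int -> F) (zprimitive g) %= map_poly intr P.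
  apply: irrP.2; first by rewrite sg gtn_eqF.
  by rewrite [P in X in _ %| X]Er rmorphM dvdp_mulIl.
by rewrite sg sP => e; rewrite e ltnn in lt_gP.
Qed.

(** * Zariski density *)

(** Ring morphisms agree on integer coefficients, so the variables decide. Compatibilities of
    evaluations and substitutions below are reduced to variables in this way. *)
Lemma mpoly_int_rmorph_ext n (S : pzRingType) (f g : {rmorphism {mpoly int[n]} -> S}) :
  (forall i, f 'X_i = g 'X_i) -> f =1 g.
Proof.
move=> fg p; rewrite [p]mpolyE !rmorph_sum; apply: eq_bigr => m _.
rewrite -mul_mpolyC !rmorphM -[p@_m]intz !rmorph_int; congr (_ * _).
by rewrite mpolyXE_id !rmorph_prod; apply: eq_bigr => i _; rewrite !rmorphXn fg.
Qed.

Section FirstVariable.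
Variable n : nat.

(** Z[t, x_1, ..., x_n] read as Z[x_1, ..., x_n][t], with t the variable of index 0. *)
Definition mpoly_to_poly : {rmorphism {mpoly int[n.+1]} -> {poly {mpoly int[n]}}} :=
  mmap intr (fun i : 'I_n.+1 => if unlift ord0 i is Some j then ('X_j)%:P else 'X).

Lemma mpoly_to_polyX i : mpoly_to_poly 'X_i =
  if unlift ord0 i is Some j then ('X_j)%:P else 'X.
Proof. by rewrite [LHS]mmapX mmap1U. Qed.

Definition mlift : {rmorphism {mpoly int[n]} -> {mpoly int[n.+1]}} :=
  mmap intr (fun i : 'I_n => 'X_(lift ord0 i)).

Definition poly_to_mpoly : {rmorphism {poly {mpoly int[n]}} -> {mpoly int[n.+1]}} :=
  horner_eval ('X_ord0 : {mpoly int[n.+1]}) \o map_poly mlift.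

Lemma mpoly_to_polyK : cancel mpoly_to_poly poly_to_mpoly.
Proof.
apply: (mpoly_int_rmorph_ext (f := poly_to_mpoly \o mpoly_to_poly) (g := idfun)) => i /=.
rewrite mpoly_to_polyX /horner_eval; case: unliftP => [j|] ->.
  by rewrite map_polyC hornerC [LHS]mmapX mmap1U.
by rewrite map_polyX hornerX.
Qed.

Lemma meval_mpoly_to_poly (S : comNzRingType) (p : {mpoly int[n.+1]}) (v : 'I_n.+1 -> S) :
  (map_mpoly intr p).@[v] =
  (map_poly (fun q => (map_mpoly intr q).@[fun i => v (lift ord0 i)])
     (mpoly_to_poly p)).[v ord0].
Proof.
pose f := meval (fun i => v (lift ord0 i)) \o map_mpoly (intr : int -> S).
apply: (mpoly_int_rmorph_ext (f := meval v \o map_mpoly (intr : int -> S))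
  (g := (horner_eval (v ord0) \o map_poly f) \o mpoly_to_poly)) => i /=.
rewrite mpoly_to_polyX /horner_eval map_mpolyX mevalXU; case: unliftP => [j|] ->.
  by rewrite map_polyC hornerC /f /= map_mpolyX mevalXU.
by rewrite map_polyX hornerX.
Qed.
End FirstVariable.

Lemma meval_mpoly_to_poly_int n (p : {mpoly int[n.+1]}) (v : 'I_n.+1 -> int) :
  p.@[v] = (map_poly (meval (fun i => v (lift ord0 i))) (mpoly_to_poly n p)).[v ord0].
Proof.
have intr_id m : @map_mpoly m int int intr =1 id.
  by apply: (mpoly_int_rmorph_ext (f := map_mpoly (intr : int -> int)) (g := idfun)) => i;
    rewrite /= map_mpolyX.
rewrite -[p in LHS]intr_id meval_mpoly_to_poly; congr (_.[_]).
by apply: eq_map_poly => q; rewrite intr_id.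
Qed.

Lemma poly_cofinite_eq0 (q : {poly int}) (c : int) (M : nat) :
  (forall m : nat, (M < m)%N -> q.[c + 11 * m%:Z] = 0) -> q = 0.
Proof.
move=> q0; apply: contraTeq isT => nz.
pose rs := [seq c + 11 * k%:Z | k <- iota M.+1 (size q)].
have : (size rs < size q)%N.
  apply: max_poly_roots => //.
    by apply/allP=> z /mapP[k]; rewrite mem_iota => /andP[kM _] ->; apply/rootP/q0.
  by rewrite map_inj_uniq ?iota_uniq // => k l; lia.
by rewrite size_map size_iota ltnn.
Qed.

(* The points x with 4 x_j < x_i for i < j form a Zariski dense set, as the last
   coordinate chosen is the first one and ranges over all large integers. *)
Lemma mpoly_lacunary_eq0 n (p : {mpoly int[n]}) (c : 'I_n -> int) :
  (forall x : 'I_n -> nat, (forall i j : 'I_n, (i < j)%N -> (4 * x j < x i)%N) ->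
    p.@[fun i => c i + 11 * (x i)%:Z] = 0) -> p = 0.
Proof.
elim: n p c => [|n IH] p c p0.
  have E : p = (p.@[fun i => c i + 11 * 0])%:MP.
    by apply: (mpoly_int_rmorph_ext (f := idfun)
      (g := mpolyC 0 (R := int) \o meval _)) => -[].
  by rewrite E (p0 (fun=> 0%N)) // => -[].
rewrite -[p]mpoly_to_polyK (_ : mpoly_to_poly n p = 0) ?rmorph0 //.
apply/polyP=> k; rewrite coef0; apply: (IH _ (fun i => c (lift ord0 i))) => x hx.
rewrite -coef_map; set q := map_poly _ _.
suff -> : q = 0 by rewrite coef0.
(* Once the other coordinates are fixed, the first may be any [m] above four times their maximum,
   which gives infinitely many roots. *)
apply: (@poly_cofinite_eq0 _ (c ord0) (4 * \max_i x i)%N) => m hm.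
pose y i := if unlift ord0 i is Some j then x j else m.
have /p0 : forall i j : 'I_n.+1, (i < j)%N -> (4 * y j < y i)%N.
  move=> i j; rewrite /y; case: (unliftP ord0 j) => [j'|] -> //.
  case: (unliftP ord0 i) => [i'|] -> /=; first by rewrite ltnS; exact: hx.
  by move=> _; apply: leq_ltn_trans hm; rewrite leq_mul2l leq_bigmax.
rewrite meval_mpoly_to_poly_int /y unlift_none => <-; congr (_.[_]).
by apply: eq_map_poly => r; apply: meval_eq => i; rewrite liftK.
Qed.

(** * Divisibility by the product of discriminants *)

Definition heron_poly {S : comNzRingType} (s1 s2 s3 s4 : S) : {poly S} :=
  heron4 'X s1%:P s2%:P s3%:P s4%:P.

Lemma map_heron_poly (S T : comNzRingType) (f : {rmorphism S -> T}) (s1 s2 s3 s4 : S) :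
  map_poly f (heron_poly s1 s2 s3 s4) = heron_poly (f s1) (f s2) (f s3) (f s4).
Proof.
apply: etrans (rmorph_heron4 (map_poly f) _ _ _ _ _) _.
by apply: eq_heron4; [exact: map_polyX | exact: map_polyC..].
Qed.

Lemma size_polyM_leq (S : nzSemiRingType) (p q : {poly S}) m n :
  (size p <= m.+1)%N -> (size q <= n.+1)%N -> (size (p * q)%R <= (m + n).+1)%N.
Proof.
move=> hp hq; apply: leq_trans (size_polyMleq p q) _.
by rewrite -ltnS; case: (size p + size q)%N (leq_add hp hq) => [|k] //=;
  rewrite addSn addnS.
Qed.

(** In t, the even part has leading term t^3 and the odd part has degree at most 1, so the square of
    the even part dominates. *)
Lemma monic_heron_poly (S : comNzRingType) (s1 s2 s3 s4 : S) :
  heron_poly s1 s2 s3 s4 \is monic /\ size (heron_poly s1 s2 s3 s4) = 7%N.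
Proof.
rewrite /heron_poly /heron4 /heron_even /heron_odd.
have n_poly n : n%:R = n%:R%:P :> {poly S} by rewrite polyC_natr.
rewrite (n_poly 4) (n_poly 64) (n_poly 72) (n_poly 432) (n_poly 864).
move: (4%:R : S) (64%:R : S) (72%:R : S) (432%:R : S) (864%:R : S).
move=> n1 n2 n3 n4 n5 {n_poly}.
set F := (X in X ^+ 2 - _); set G := (X in _ - _ * X ^+ 2).
pose k := n1 * s2; pose a2 := s1 ^+ 2 - (k + k + k).
pose a1 := k ^+ 2 + k ^+ 2 + k ^+ 2 - s1 ^+ 2 * (k + k) - n3 * s1 * s3 - n4 * s4.
pose a0 := s1 ^+ 2 * k ^+ 2 - k ^+ 3 - n2 * s1 ^+ 3 * s3 + n3 * s1 * k * s3
  - n4 * s3 ^+ 2.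
have FE : F = 'X^3 + Poly [:: a0; a1; a2].
  rewrite /F /= !cons_poly_def /a0 /a1 /a2 /k.
  by rewrite !(polyCD, polyCN, polyCM, rmorphXn) /=; ring.
have GE : G = Poly [:: n3 * s1 * k - n2 * s1 ^+ 3 - n5 * s3; - (n3 * s1)].
  rewrite /G /= !cons_poly_def /k.
  by rewrite !(polyCD, polyCN, polyCM, rmorphXn) /=; ring.
have sF : size F = 4%N by rewrite FE size_polyDl size_polyXn // ltnS size_Poly.
have mF : F \is monic.
  by rewrite monicE FE lead_coefDl ?lead_coefXn // size_polyXn ltnS size_Poly.
have sG : (size G <= 2)%N by rewrite GE size_Poly.
have sF2 : size (F ^+ 2) = 7%N.
  by rewrite expr2 size_monicM ?monic_neq0 ?sF.
have sX : (size (- ('X * s4%:P * G ^+ 2)) < 7)%N.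
  rewrite size_polyN (@leq_ltn_trans 4) // (@size_polyM_leq _ _ _ 1 2) //.
    by rewrite (@size_polyM_leq _ _ _ 1 0) ?size_polyX ?size_polyC_leq1.
  by rewrite expr2 (@size_polyM_leq _ _ _ 1 1).
split; last by rewrite size_polyDl sF2.
by rewrite monicE lead_coefDl ?sF2 // -monicE monic_exp.
Qed.

(** Vieta's formulas, read off the expanded product of the ['X - (v i)%:P]. *)
Lemma mesym4E (v : 'I_4 -> int) :
  [/\ (mesym 4 int 1).@[v] = v 0 + v 1 + v 2 + v ord_max,
      (mesym 4 int 2).@[v] = v 0 * v 1 + v 0 * v 2 + v 0 * v ord_max + v 1 * v 2
        + v 1 * v ord_max + v 2 * v ord_max,
      (mesym 4 int 3).@[v] = v 0 * v 1 * v 2 + v 0 * v 1 * v ord_max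
        + v 0 * v 2 * v ord_max + v 1 * v 2 * v ord_max
    & (mesym 4 int 4).@[v] = v 0 * v 1 * v 2 * v ord_max].
Proof.
pose cs := [tuple v i | i < 4].
have coefs (k : 'I_5) :
    (mesym 4 int k).@[v] = (-1) ^+ k * (\prod_(c <- cs) ('X - c%:P))`_(4 - k).
  rewrite mroots_coeff mulrA -expr2 sqrr_sign mul1r; apply: meval_eq => i.
  by rewrite tnth_mktuple.
have E : \prod_(c <- cs) ('X - c%:P) = 'X^4 - (v 0 + v 1 + v 2 + v ord_max)%:P * 'X^3
   + (v 0 * v 1 + v 0 * v 2 + v 0 * v ord_max + v 1 * v 2
        + v 1 * v ord_max + v 2 * v ord_max)%:P * 'X^2
   - (v 0 * v 1 * v 2 + v 0 * v 1 * v ord_max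
        + v 0 * v 2 * v ord_max + v 1 * v 2 * v ord_max)%:P * 'X
   + (v 0 * v 1 * v 2 * v ord_max)%:P.
  rewrite big_tuple !big_ord_recl big_ord0 !tnth_mktuple.
  have -> : lift ord0 ord0 = 1 :> 'I_4 by apply: val_inj.
  have -> : lift ord0 (lift ord0 ord0) = 2 :> 'I_4 by apply: val_inj.
  have -> : lift ord0 (lift ord0 (lift ord0 ord0)) = ord_max :> 'I_4 by apply: val_inj.
  by rewrite !(polyCD, polyCM); ring.
split; [rewrite (coefs 1)|rewrite (coefs 2)|rewrite (coefs 3)|rewrite (coefs ord_max)];
  by rewrite E !(coefD, coefN, coefCM, coefXn, coefX, coefC) /=; ring.
Qed.

Lemma mpoly_to_poly_heron :
  mpoly_to_poly 4 (heron_sigma \mPo sigma_subst 4) =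
  heron_poly (mesym 4 int 1) (mesym 4 int 2) (mesym 4 int 3) (mesym 4 int 4).
Proof.
have sE k : (0 < k < 5)%N ->
    mpoly_to_poly 4 (sigma k \mPo sigma_subst 4) = (mesym 4 int k)%:P.
  move=> /andP[k0 k5]; rewrite comp_mpolyXU -tnth_nth tnth_mktuple inordK //.
  rewrite ifF; last by rewrite -val_eqE /= inordK // gtn_eqF.
  pose lq := [tuple ('X_(lift ord0 j) : {mpoly int[5]}) | j < 4].
  apply: (mpoly_int_rmorph_ext (f := mpoly_to_poly 4 \o comp_mpoly lq)
    (g := polyC)) => j /=.
  by rewrite comp_mpolyXU -tnth_nth tnth_mktuple mpoly_to_polyX liftK.
apply: etrans (rmorph_heron4 (mpoly_to_poly 4 \o comp_mpoly (sigma_subst 4)) _ _ _ _ _) _.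
apply: eq_heron4; [|exact: sE..].
by rewrite /= comp_mpolyXU -tnth_nth tnth_mktuple eqxx mpoly_to_polyX unlift_none.
Qed.

(* Modulo 11, sigma_1, ..., sigma_4 are 4, 10, 6, 10 at this point, found by search
   so that the resulting sextic in t is irreducible. *)
Definition base_point (i : 'I_4) : int := [:: 9; 1; 2; 3]`_i.

Lemma heron_poly_mod11 (x : 'I_4 -> nat) :
  let v i := base_point i + 11 * (x i)%:Z in
  map_poly (intr : int -> 'F_11) (heron_poly (mesym 4 int 1).@[v]
    (mesym 4 int 2).@[v] (mesym 4 int 3).@[v] (mesym 4 int 4).@[v]) = sextic_mod11.
Proof.
move=> v; rewrite map_heron_poly.
have vE i : (v i)%:~R = (base_point i)%:~R :> 'F_11.
  rewrite /v rmorphD rmorphM /= (_ : 11%:~R = 0 :> 'F_11) ?mul0r ?addr0 //.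
  by apply/val_inj.
have [-> -> -> ->] := mesym4E v.
clearbody v; rewrite !(rmorphD, rmorphM) /= !vE.
have e0 (m : nat) (y : 'F_11) : val y == val (m%:R : 'F_11) -> y%:P = m%:R.
  by move=> /eqP/val_inj ->; rewrite polyC_natr.
have h11 : 11%:R = 0 :> {poly 'F_11} by rewrite -(e0 11%N 0) ?polyC0.
set y1 := (X in heron_poly X); have E1 : y1%:P = 4%:R by apply: e0.
set y2 := (X in heron_poly _ X); have E2 : y2%:P = 10%:R by apply: e0.
set y3 := (X in heron_poly _ _ X); have E3 : y3%:P = 6%:R by apply: e0.
set y4 := (X in heron_poly _ _ _ X); have E4 : y4%:P = 10%:R by apply: e0.
rewrite /heron_poly E1 E2 E3 E4.
(* The multiple of 11 in each congruence is written out, making it an integer identity for [ring];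
   [h11] then removes it. *)
have F_mod11 : heron_even 'X 4 10 6 10 = 'X^3 - 5 * 'X^2 + 2 * 'X - 3 :> {poly 'F_11}.
  transitivity ('X^3 - 5 * 'X^2 + 2 * 'X - 3
    - 11 * (9 * 'X^2 + 230 * 'X + 855) : {poly 'F_11}).
    by rewrite /heron_even; ring.
  by rewrite h11 mul0r subr0.
have G_mod11 : heron_odd 'X 4 10 6 = - (2 * 'X) - 4 :> {poly 'F_11}.
  transitivity (- (2 * 'X) - 4 + 11 * (204 - 26 * 'X) : {poly 'F_11}).
    by rewrite /heron_odd; ring.
  by rewrite h11 mul0r addr0.
rewrite sextic_mod11E /heron4 F_mod11 G_mod11.
have -> : 'X * 10 = - 'X + 11 * 'X :> {poly 'F_11} by ring.
rewrite h11 mul0r addr0.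
transitivity ('X^6 + 'X^5 + 7 * 'X^4 + 6 * 'X^2 + 4 * 'X + 9
  + 11 * (4 * 'X^2 - 2 * 'X^3 + 2 * 'X^4 - 'X^5) : {poly 'F_11}); first by ring.
by rewrite h11 mul0r addr0.
Qed.

Lemma horner_heron_poly (S : comNzRingType) (s1 s2 s3 s4 t : S) :
  (heron_poly s1 s2 s3 s4).[t] = heron4 t s1 s2 s3 s4.
Proof.
apply: etrans (rmorph_heron4 (horner_eval t) _ _ _ _ _) _.
by apply: eq_heron4; [exact: hornerX | exact: hornerC..].
Qed.

Lemma meval_intr n (S : comNzRingType) (p : {mpoly int[n]}) (v : 'I_n -> int) :
  (map_mpoly intr p).@[fun i => (v i)%:~R] = (p.@[v])%:~R :> S.
Proof.
apply: (mpoly_int_rmorph_ext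
  (f := meval (fun i => (v i)%:~R) \o map_mpoly (intr : int -> S))
  (g := intr \o meval v)) => i /=.
by rewrite map_mpolyX !mevalXU.
Qed.

Lemma heron_dvd_semicyclic (R : realType) (alpha : {mpoly int[5]}) :
  (forall (P : 'I_5 -> R * R) (k : 'I_5), semicyclic P k ->
     (map_mpoly (intr : int -> R) alpha).@[semicyclic_point P k] = 0) ->
  exists q, alpha = q * (heron_sigma \mPo sigma_subst 4).
Proof.
move=> alpha0; set B := heron_sigma \mPo _.
have [mB sB] := monic_heron_poly (mesym 4 int 1) (mesym 4 int 2)
  (mesym 4 int 3) (mesym 4 int 4).
rewrite -mpoly_to_poly_heron -/B in mB sB.
have dB := Pdiv.RingMonic.rdivp_eq mB (mpoly_to_poly 4 alpha).
set q := Pdiv.Ring.rdivp _ _ in dB; set r := Pdiv.Ring.rmodp _ _ in dB.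
suff r0 : r = 0.
  exists (poly_to_mpoly 4 q); rewrite -[LHS]mpoly_to_polyK dB r0 addr0 rmorphM.
  by rewrite mpoly_to_polyK.
have sr : (size r < 7)%N by rewrite -sB Pdiv.Ring.ltn_rmodpN0 // monic_neq0.
apply/polyP=> k; rewrite coef0; apply: (mpoly_lacunary_eq0 (c := base_point)) => x hx.
pose v i := base_point i + 11 * (x i)%:Z; rewrite -/v -coef_map.
suff -> : map_poly (meval v) r = 0 by rewrite coef0.
have BE : map_poly (meval v) (mpoly_to_poly 4 B) = heron_poly (mesym 4 int 1).@[v]
    (mesym 4 int 2).@[v] (mesym 4 int 3).@[v] (mesym 4 int 4).@[v].
  by rewrite mpoly_to_poly_heron map_heron_poly.
have v0 i : 0 < v i.
  by rewrite /v; case: i => -[|[|[|[|//]]]] i4; rewrite /base_point /=; lia.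
(* The strict bound [4 * x i < x 0] leaves a slack of 11, enough for the base point since
   [4 * 3 <= 9 + 11]. *)
have v4 (i : 'I_4) : (0 < i)%N -> 4 * v i <= v 0.
  move=> i0; have := hx 0 i i0; rewrite /v.
  by case: i i0 => -[|[|[|[|//]]]] i4 // _; rewrite /base_point /=; lia.
have [||t [P [j [Pj pE h0]]]] := @exists_semicyclic_pentagon R (fun i => (v i)%:~R).
- by move=> i; rewrite ltr0z.
- by move=> i /v4; rewrite -(ler_int R) intrM.
have rootB : root (map_poly intr (map_poly (meval v) (mpoly_to_poly 4 B))) t.
  apply/rootP; rewrite BE map_heron_poly horner_heron_poly -[RHS]h0.
  have [-> -> -> ->] := mesym4E v.
  by apply: eq_heron4 => //; clearbody v; rewrite !(rmorphD, rmorphM).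
apply: (@small_root_eq0 R 'F_11 (map_poly (meval v) (mpoly_to_poly 4 B)) _ t).
- exact: monic_map.
- by rewrite BE heron_poly_mod11; exact: irreducible_sextic_mod11.
- exact: rootB.
- have := alpha0 P j Pj; rewrite meval_mpoly_to_poly.
  rewrite pE unlift_none.
  have -> : map_poly (fun p =>
        (map_mpoly intr p).@[fun i => semicyclic_point P j (lift ord0 i)])
      (mpoly_to_poly 4 alpha) =
    map_poly (intr : int -> R) (map_poly (meval v) (mpoly_to_poly 4 alpha)).
    rewrite -map_poly_comp; apply: eq_map_poly => z /=; rewrite -meval_intr.
    by apply: meval_eq => i; rewrite pE liftK.
  rewrite dB !rmorphD !rmorphM hornerD hornerM (rootP rootB) mulr0 add0r.
  by move/rootP.
(* Evaluation can only lower the degree of [r], while the monic divisor keeps size 7. *)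
- rewrite [X in (_ < X)%N](_ : _ = 7%N); last by rewrite BE (monic_heron_poly _ _ _ _).2.
  by apply: leq_ltn_trans sr; rewrite size_poly.
Qed.

(** * Identification of alpha by irreducibility and monicity *)

Lemma monic_mpoly_to_poly n (p : {mpoly int[n.+1]}) :
  monic_first p -> mpoly_to_poly n p \is monic.
Proof.
case=> d hd; rewrite -[p](subrK ('X_ord0 ^+ d)) addrC rmorphD rmorphXn.
rewrite mpoly_to_polyX unlift_none.
suff low : (size (mpoly_to_poly n (p - 'X_ord0 ^+ d)%R) <= d)%N.
  by rewrite monicE lead_coefDl ?lead_coefXn // size_polyXn ltnS.
rewrite [p - _]mpolyE rmorph_sum (leq_trans (size_sum _ _ _)) //.
apply/bigmax_leqP_seq => m /hd m_lt _.
move: (_@_m) => c; rewrite -mul_mpolyC -[c]intz rmorphM !rmorph_int.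
rewrite mpolyXE_id rmorph_prod big_ord_recl.
rewrite rmorphXn mpoly_to_polyX unlift_none.
have -> : \prod_(i < n) mpoly_to_poly n ('X_(lift ord0 i) ^+ m (lift ord0 i)) =
    (\prod_(i < n) 'X_i ^+ m (lift ord0 i))%:P.
  by rewrite rmorph_prod; apply: eq_bigr => i _; rewrite !rmorphXn mpoly_to_polyX liftK.
rewrite -(rmorph_int polyC) mulrCA -polyCM mulrC mul_polyC.
by rewrite (leq_trans (size_scale_leq _ _)) // size_polyXn.
Qed.

Theorem mainTheorem7 (R : realType) (alpha : {mpoly int[5]}) :
  is_alpha' R alpha ->
  exists2 A : {mpoly int[5]},
    alpha = A \mPo sigma_subst 4 &
    to_w (A \mPo u2_subst) =
      (16 * discr (cubic (- (2 * w)))) * (16 * discr (cubic (2 * w))).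
Proof.
case=> -[_ irr] /monic_mpoly_to_poly monic_alpha _ /heron_dvd_semicyclic [q def_alpha].
exists heron_sigma; last exact: heron_sigma_u2.
have [mB sB] := monic_heron_poly (mesym 4 int 1) (mesym 4 int 2)
  (mesym 4 int 3) (mesym 4 int 4).
rewrite -mpoly_to_poly_heron in mB sB.
have [uq | uB] := irr _ _ def_alpha; last first.
  move: (rmorph_unit (mpoly_to_poly 4) uB).
  by rewrite poly_unitE sB.
(* [q] is a unit, hence constant in t, and being monic it is 1. *)
have mq : mpoly_to_poly 4 q \is monic.
  by move: monic_alpha; rewrite def_alpha rmorphM monicMr.
have q1 : mpoly_to_poly 4 q = 1.
  move: (rmorph_unit (mpoly_to_poly 4) uq).
  rewrite poly_unitE => /andP[/size_poly1P[c _ qc] _].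
  by move: mq; rewrite qc monicE lead_coefC => /eqP->.
by rewrite def_alpha -[q]mpoly_to_polyK q1 rmorph1 mul1r.
Qed.
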